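(* Let $0<t<\hat t$ and suppose that the equimomental ellipsoid giving the lasso solution touches the boundary polyhedron $B(t)$ at a point $\beta$ in the relative interior of a $(p-2)$-dimensional face contained in the hyperplane $\beta_\alpha=0$, for some $\alpha\in\{1,\dots,p\}$. Then the solution of the lasso reduces to the solution of the induced $(p-1)$-dimensional lasso problem in the hyperplane $\beta_\alpha=0$: $\beta_{(\alpha)}$ is the solution of the induced lasso problem with bound $t$ and satisfies $$(K_1)_{(\alpha;\alpha)}\beta_{(\alpha)}-b_{(\alpha)}=s\,\delta_{(\alpha)}$$ for some $s<0$. The $(p-1)\times(p-1)$ covariance matrix of the induced problem is $(K_1)_{(\alpha;\alpha)}$, obtained from $K_1$ by omitting the $\alpha$-th row and the $\alpha$-th column, and the center of its equimomental ellipsoids is $\big((K_1)_{(\alpha;\alpha)}\big)^{-1}b_{(\alpha)}$.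
   Context: Let $p\ge2$. A data set consists of $N$ points $(x_1^{(i)},\dots,x_p^{(i)},y^{(i)})\in\mathbb R^{p+1}$ with centroid at the origin and not contained in any proper affine subspace (full rank assumption). Put $K_1=\frac1N\sum_i x^{(i)}(x^{(i)})^T$ ($p\times p$, positive definite), $b=\frac1N\sum_i y^{(i)}x^{(i)}\in\mathbb R^p$, $\hat\beta=K_1^{-1}b$, $\hat t=\|\hat\beta\|_1$. The lasso solution for the bound $t$ is the unique minimizer of $f(\beta)=\frac12\sum_i\big(y^{(i)}-\sum_j\beta_jx_j^{(i)}\big)^2$ over $\beta\in\mathbb R^p$ with $\sum_j|\beta_j|\le t$; equivalently, of $\langle K_1\beta,\beta\rangle-2\langle b,\beta\rangle$. The equimomental ellipsoids are the level sets $\langle K_1(\beta-\hat\beta),\beta-\hat\beta\rangle=\text{const}$, and $B(t)=\{\sum_j|\beta_j|=t\}$; for $0<t<\hat t$ the lasso solution is the point of contact of $B(t)$ with the smallest equimomental ellipsoid touching it. For a vector $v\in\mathbb R^p$, $v_{(\alpha)}\in\mathbb R^{p-1}$ is obtained by omitting the $\alpha$-th coordinate. The induced lasso problem in the hyperplane $\beta_\alpha=0$ is the minimization of $\langle (K_1)_{(\alpha;\alpha)}\gamma,\gamma\rangle-2\langle b_{(\alpha)},\gamma\rangle$ over $\gamma\in\mathbb R^{p-1}$ with $\|\gamma\|_1\le t$; its equimomental ellipsoids are the level sets of this function. $\delta_{(\alpha)}\in\{-1,1\}^{p-1}$ denotes the vector of signs of the coordinates of the face, i.e. of $\beta_{(\alpha)}$.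 *)

(* Defs.v *)
From HB Require Import structures.
From mathcomp Require Import all_boot all_order all_algebra.
From mathcomp Require Import boolp classical_sets reals.
From mathcomp Require Import topology normedtype.

Set Implicit Arguments.
Unset Strict Implicit.
Unset Printing Implicit Defensive.

Import Order.TTheory GRing.Theory Num.Theory.
Import numFieldNormedType.Exports.

Local Open Scope classical_set_scope.
Local Open Scope ring_scope.

Section Geometry.
Context {R : realType} {n : nat}.
Implicit Types (u v : 'cV[R]_n) (M : 'M[R]_n) (A F P : set 'cV[R]_n).

Definition dotp u v : R := \sum_(j < n) u j 0 * v j 0.

Definition l1norm v : R := \sum_(j < n) `|v j 0|.

Definition l1ball (t : R) : set 'cV[R]_n := [set v | l1norm v <= t].

Definition l1sphere (t : R) : set 'cV[R]_n := [set v | l1norm v = t].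

Definition posdef M : Prop :=
  M^T = M /\ forall v, v != 0 -> 0 < dotp (M *m v) v.

Definition ellipsoid M (c : 'cV[R]_n) (r : R) : set 'cV[R]_n :=
  [set v | dotp (M *m (v - c)) (v - c) = r].

(* The shift k is the same for all levels, so that the two one-parameter
   families of sets coincide. *)
Definition level_sets_are_ellipsoids (g : 'cV[R]_n -> R) M (c : 'cV[R]_n) :
    Prop :=
  posdef M /\ exists k, forall r, [set v | g v = k + r] = ellipsoid M c r.

Definition minimizer (g : 'cV[R]_n -> R) A v : Prop :=
  A v /\ forall w, A w -> g v <= g w.

Definition affine_subspace (d : nat) A : Prop :=
  exists (v0 : 'cV[R]_n) (U : {vspace 'cV[R]_n}),
    \dim U = d /\ A = [set v | v - v0 \in U].

Definition affine_hull A : set 'cV[R]_n :=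
  smallest [set B | exists d, affine_subspace d B] A.

Definition relative_interior A : set 'cV[R]_n :=
  [set v | A v /\ within (affine_hull A) (nbhs v) A].

(* For a polytope the faces are the exposed faces.  Taking c = 0 also allows
   P itself and the empty set. *)
Definition face P F : Prop :=
  exists (c : 'cV[R]_n) (m : R),
    (forall v, P v -> dotp c v <= m) /\ F = P `&` [set v | dotp c v = m].

Definition face_of_dim (d : nat) P F : Prop :=
  face P F /\ affine_subspace d (affine_hull F).

Definition quad_objective M (c v : 'cV[R]_n) : R :=
  dotp (M *m v) v - 2 * dotp c v.

End Geometry.

Section Data.
Context {R : realType} {N p : nat}.
Variables (x : 'I_N -> 'cV[R]_p) (y : 'I_N -> R).

Definition centred : Prop := \sum_(i < N) x i = 0 /\ \sum_(i < N) y i = 0.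

Definition data_point (i : 'I_N) : 'cV[R]_(p + 1) := col_mx (x i) (y i)%:M.

Definition full_rank : Prop :=
  forall d (A : set 'cV[R]_(p + 1)),
    affine_subspace d A -> (forall i, A (data_point i)) -> A = setT.

(* The covariance formulas below presuppose centred data. *)
Definition covariance : 'M[R]_p := N%:R^-1 *: \sum_(i < N) x i *m (x i)^T.

Definition cross_moment : 'cV[R]_p := N%:R^-1 *: \sum_(i < N) y i *: x i.

Definition ols : 'cV[R]_p := invmx covariance *m cross_moment.

Definition lasso_objective (beta : 'cV[R]_p) : R :=
  2^-1 * \sum_(i < N) (y i - \sum_(j < p) beta j 0 * x i j 0) ^+ 2.

Definition lasso_solution (t : R) : 'cV[R]_p -> Prop :=
  unique (minimizer lasso_objective (l1ball t)).

Definition equimomental (r : R) : set 'cV[R]_p := ellipsoid covariance ols r.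

(* Equimomental ellipsoids grow with their level, so the smallest one is the
   one of least level. *)
Definition smallest_touching (t r : R) : Prop :=
  equimomental r `&` l1sphere t !=set0 /\
  forall r', equimomental r' `&` l1sphere t !=set0 -> r <= r'.

Definition induced_objective (alpha : 'I_p) : 'cV[R]_p.-1 -> R :=
  quad_objective (row' alpha (col' alpha covariance)) (row' alpha cross_moment).

Definition induced_lasso_solution (alpha : 'I_p) (t : R) :
    'cV[R]_p.-1 -> Prop :=
  unique (minimizer (induced_objective alpha) (l1ball t)).

End Data.

Definition sign_vector {R : realType} {n : nat} (v : 'cV[R]_n) : 'cV[R]_n :=
  map_mx Num.sg v.

(* Main.v *)
(** The negative gradient g = b - K_1 beta of the quadratic objective at the
    lasso solution attains its maximum over the l1 ball at beta; equality in
    Hoelder's inequality then gives g_j = G sgn(beta_j) wherever beta_j != 0,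
    with G the sup norm of g, and G = 0 would force beta to be the least squares
    solution, which lies outside the ball.  The same duality applied to the
    linear form defining the face shows that a relative interior point of a
    (p-2)-dimensional face inside beta_alpha = 0 has no other zero coordinate.
    Deleting the row alpha of the equation g = G sgn(beta) gives the induced
    system. *)

Require Import Defs.
From mathcomp Require Import all_boot all_order all_algebra.
From mathcomp Require Import boolp classical_sets reals.
From mathcomp Require Import topology normedtype.
From mathcomp Require Import ring lra.
Import Order.TTheory GRing.Theory Num.Theory.
Import numFieldNormedType.Exports.
Local Open Scope classical_set_scope.
Local Open Scope ring_scope.

Set Implicit Arguments.
Unset Strict Implicit.
Unset Printing Implicit Defensive.

(** * Quadratic forms: completing the square, first-order optimality, uniqueness *)

Section Dotp.
Context {R : realType} {n : nat}.
Implicit Types (u v w c : 'cV[R]_n) (M : 'M[R]_n).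

Lemma dotp_trmul u v : dotp u v = (u^T *m v) 0 0.
Proof. by rewrite mxE; apply: eq_bigr => j _; rewrite mxE. Qed.

Lemma dotpC u v : dotp u v = dotp v u.
Proof. by apply: eq_bigr => j _; rewrite mulrC. Qed.

Lemma dotpDr u v w : dotp u (v + w) = dotp u v + dotp u w.
Proof. by rewrite !dotp_trmul mulmxDr mxE. Qed.

Lemma dotpZr (a : R) u v : dotp u (a *: v) = a * dotp u v.
Proof. by rewrite !dotp_trmul -scalemxAr mxE. Qed.

Lemma dotpNr u v : dotp u (- v) = - dotp u v.
Proof. by rewrite -scaleN1r dotpZr mulN1r. Qed.

Lemma dotpDl u v w : dotp (u + v) w = dotp u w + dotp v w.
Proof. by rewrite !(dotpC _ w) dotpDr. Qed.

Lemma dotpZl (a : R) u v : dotp (a *: u) v = a * dotp u v.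
Proof. by rewrite !(dotpC _ v) dotpZr. Qed.

Lemma dotpNl u v : dotp (- u) v = - dotp u v.
Proof. by rewrite !(dotpC _ v) dotpNr. Qed.

Definition dotpE := (dotpDl, dotpDr, dotpZl, dotpZr, dotpNl, dotpNr).

Lemma dotp_sym M u v : M^T = M -> dotp (M *m u) v = dotp (M *m v) u.
Proof.
by move=> MT; rewrite (dotpC (M *m v)) !dotp_trmul trmx_mul MT mulmxA.
Qed.

Lemma dotp_delta u j : dotp u (delta_mx j 0) = u j 0.
Proof.
rewrite /dotp (bigD1 j) //= mxE !eqxx mulr1 big1 ?addr0 // => i /negbTE ij.
by rewrite mxE ij mulr0.
Qed.

Lemma dotp_eq0 v : dotp v v = 0 -> v = 0.
Proof.
move=> /eqP; rewrite psumr_eq0 => [|j _]; last by rewrite -expr2 sqr_ge0.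
move=> /allP v0; apply/colP => j; rewrite mxE.
by have := v0 j (mem_index_enum _); rewrite /= mulf_eq0 orbb => /eqP.
Qed.

Lemma posdef_unitmx M : posdef M -> M \in unitmx.
Proof.
move=> [MT Mpos]; rewrite unitmxE unitfE; apply/negP => /det0P[v v0 vM].
have vT0 : v^T != 0 by rewrite -trmx0 (inj_eq (@trmx_inj _ _ _)).
have := Mpos _ vT0; rewrite dotp_trmul trmx_mul MT trmxK vM mul0mx mxE.
by rewrite ltxx.
Qed.

Lemma posdef_ge0 M v : posdef M -> 0 <= dotp (M *m v) v.
Proof.
move=> [_ Mpos]; have [->|/Mpos/ltW//] := eqVneq v 0.
by rewrite mulmx0 dotp_trmul mulmx0 mxE.
Qed.

(** Completion of the square: by symmetry of [M] the linear term in [c] is a cross term with the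
    centre [invmx M *m c]. *)
Lemma quad_objective_center M c v : posdef M ->
  quad_objective M c v =
    - dotp c (invmx M *m c)
    + dotp (M *m (v - invmx M *m c)) (v - invmx M *m c).
Proof.
move=> Mpd; have [MT _] := Mpd.
have Mu : M *m (invmx M *m c) = c by rewrite mulKVmx // posdef_unitmx.
rewrite /quad_objective mulmxBr Mu.
have -> : dotp c v = dotp (M *m v) (invmx M *m c) by rewrite dotp_sym // Mu.
rewrite !dotpE.
have -> : dotp c v = dotp (M *m v) (invmx M *m c) by rewrite dotp_sym // Mu.
ring.
Qed.

Lemma posdef_level_sets M c : posdef M ->
  level_sets_are_ellipsoids (quad_objective M c) M (invmx M *m c).
Proof.
move=> Mpd; split=> //; exists (- dotp c (invmx M *m c)) => r.
apply/seteqP; split=> v /=; rewrite quad_objective_center //.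
  by move=> /addrI.
by move=> ->.
Qed.

(** The exact second-order Taylor expansion along [w], with gradient [2 * (M *m v - c)]. *)
Lemma quad_objectiveD M c v w (h : R) : M^T = M ->
  quad_objective M c (v + h *: w) =
    quad_objective M c v + 2 * h * dotp (M *m v - c) w
    + h ^+ 2 * dotp (M *m w) w.
Proof.
move=> MT; rewrite /quad_objective mulmxDr -scalemxAr !dotpE.
rewrite (dotp_sym w v MT); ring.
Qed.

Lemma quad_variational_inequality M c (A : set 'cV[R]_n) v w :
  posdef M -> minimizer (quad_objective M c) A v ->
  (forall h : R, 0 <= h <= 1 -> A (v + h *: (w - v))) ->
  0 <= dotp (M *m v - c) (w - v).
Proof.
move=> Mpd [Av vmin] Aw; have [MT _] := Mpd.
rewrite leNgt; apply/negP => a0.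
have e0 := posdef_ge0 (w - v) Mpd.
set a := dotp (M *m v - c) (w - v) in a0 *; set e := dotp (M *m _) _ in e0.
have ea : 0 < e - a by lra.
(* Unlike the line minimizer [- a / e], this step exists when [e = 0] and never exceeds 1. With it,
   the change [2 * h * a + h ^+ 2 * e] collapses to [h * a + h ^+ 2 * a], which is negative. *)
pose h := - a / (e - a).
have h0 : 0 < h by rewrite divr_gt0 ?oppr_gt0.
have h1 : h <= 1 by rewrite ler_pdivrMr //; lra.
have := vmin _ (Aw h _); rewrite (ltW h0) h1 => /(_ isT).
rewrite quad_objectiveD // -/a -/e.
have he : h * e = h * a - a.
  have : h * (e - a) = - a by rewrite divfK ?gt_eqF.
  by rewrite mulrBr; lra.
have -> : h ^+ 2 * e = h * (h * a - a) by rewrite -he; ring.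
have : h * a < 0 by rewrite pmulr_rlt0.
nra.
Qed.

(** In the expansion from [v] to another point of [A], the linear term is nonnegative by the
    variational inequality and the quadratic term is strictly positive. *)
Lemma quad_minimizer_unique M c (A : set 'cV[R]_n) v :
  posdef M ->
  (forall w, A w -> forall h : R, 0 <= h <= 1 -> A (v + h *: (w - v))) ->
  minimizer (quad_objective M c) A v ->
  unique (minimizer (quad_objective M c) A) v.
Proof.
move=> Mpd Aconv vmin; split=> // w [Aw wmin]; apply/eqP/negPn/negP => vw.
have := quad_variational_inequality Mpd vmin (Aconv w Aw).
have := wmin v vmin.1.
have -> : w = v + 1 *: (w - v) by rewrite scale1r addrC subrK.
rewrite quad_objectiveD ?Mpd.1 //.
have /Mpd.2 : w - v != 0 by rewrite subr_eq0 eq_sym.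
rewrite scale1r [v + (w - v)]addrC subrK; lra.
Qed.

End Dotp.

(** * The l1 ball, its duality with the sup norm, and crossings of its boundary *)

Section L1norm.
Context {R : realType} {n : nat}.
Implicit Types (u v w c : 'cV[R]_n) (t m h : R).

Lemma ler_l1normD u v : l1norm (u + v) <= l1norm u + l1norm v.
Proof.
by rewrite -big_split; apply: ler_sum => j _; rewrite mxE ler_normD.
Qed.

Lemma l1normZ h v : l1norm (h *: v) = `|h| * l1norm v.
Proof. by rewrite mulr_sumr; apply: eq_bigr => j _; rewrite mxE normrM. Qed.

Lemma ler_l1norm v j : `|v j 0| <= l1norm v.
Proof. by rewrite /l1norm (bigD1 j) //= lerDl sumr_ge0. Qed.

Lemma l1norm_ge0 v : 0 <= l1norm v. Proof. exact: sumr_ge0. Qed.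

Lemma l1norm_delta j : l1norm (delta_mx j 0 : 'cV[R]_n) = 1.
Proof.
rewrite /l1norm (bigD1 j) //= mxE !eqxx normr1 big1 ?addr0 // => i /negbTE ij.
by rewrite mxE ij normr0.
Qed.

Lemma l1ball_convex t v w h : l1ball t v -> l1ball t w -> 0 <= h <= 1 ->
  l1ball t (v + h *: (w - v)).
Proof.
rewrite /l1ball /= => vt wt /andP[h0 h1].
have -> : v + h *: (w - v) = (1 - h) *: v + h *: w.
  by rewrite scalerBr scalerBl scale1r addrCA addrC -addrA [- _ + _]addrC.
apply: le_trans (ler_l1normD _ _) _.
rewrite !l1normZ (ger0_norm h0) ger0_norm ?subr_ge0 //.
have := l1norm_ge0 v; have := l1norm_ge0 w; nra.
Qed.

(** The vertex on axis [j] where [c] is largest; since [Num.sg 0 = 0], it degenerates to the origin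
    when [c j 0] vanishes. *)
Lemma l1ball_vertex t c j : 0 <= t ->
  l1ball t (t * Num.sg (c j 0) *: delta_mx j 0 : 'cV[R]_n).
Proof.
move=> t0; rewrite /l1ball /= l1normZ l1norm_delta mulr1 normrM ger0_norm //.
by rewrite normr_sg ler_piMr // lern1 leq_b1.
Qed.

Lemma dotp_vertex t c j :
  dotp c (t * Num.sg (c j 0) *: delta_mx j 0) = t * `|c j 0|.
Proof. by rewrite dotpZr dotp_delta normrEsg; ring. Qed.

(* The level M is the dual norm of c: the maximum of c on the ball is t * M. *)
Lemma l1ball_support c m t v : 0 < t ->
  (forall w, l1ball t w -> dotp c w <= m) -> l1ball t v -> dotp c v = m ->
  exists M, [/\ 0 <= M, m = t * M, forall j, `|c j 0| <= M &
    forall j, v j 0 != 0 -> c j 0 = M * Num.sg (v j 0)].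
Proof.
move=> t0 cm vt cv; exists (m / t); have tn0 : t != 0 by rewrite gt_eqF.
have M0 : 0 <= m / t.
  rewrite divr_ge0 ?(ltW t0) //; have := cm 0.
  rewrite /l1ball /= dotp_trmul mulmx0 mxE; apply.
  by rewrite -(scale0r (0 : 'cV_n)) l1normZ normr0 mul0r ltW.
have mM : m = t * (m / t) by rewrite mulrC divfK.
have cM j : `|c j 0| <= m / t.
  by rewrite ler_pdivlMr // mulrC -dotp_vertex; apply/cm/l1ball_vertex/ltW.
split=> // j vj0.
have term_ge0 i : 0 <= m / t * `|v i 0| - c i 0 * v i 0.
  by rewrite subr_ge0 (le_trans (ler_norm _)) // normrM ler_wpM2r.
(* Equality case of Hoelder: the sum is [m / t * l1norm v - m], at most 0, while its terms are
   nonnegative; hence each term vanishes. *)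
have : \sum_i (m / t * `|v i 0| - c i 0 * v i 0) = 0.
  apply/eqP; rewrite eq_le sumr_ge0 // andbT sumrB -mulr_sumr -/(l1norm v).
  by rewrite -/(dotp c v) cv subr_le0 {2}mM mulrC ler_wpM2r.
move=> /eqP; rewrite psumr_eq0 // => /allP /(_ j (mem_index_enum _)) /=.
rewrite subr_eq0 => /eqP vjE.
apply: (mulIf vj0); by rewrite -vjE -[RHS]mulrA -normrEsg.
Qed.

Lemma l1sphere_crossing t v w : l1norm v <= t <= l1norm w ->
  exists2 h, 0 <= h <= 1 & l1norm (v + h *: (w - v)) = t.
Proof.
move=> /andP[vt tw]; pose f h := l1norm (v + h *: (w - v)).
have fc : continuous f.
  apply: continuous_big => [|j _ h]; first exact: add_continuous.
  apply: cvg_norm; rewrite !mxE; under eq_fun do rewrite !mxE.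
  by apply: cvgD; [exact: cvg_cst | apply: cvgMr_tmp; exact: cvg_id].
have [||h] := @IVT R f 0 1 t ler01.
- exact: continuous_subspaceT.
- by rewrite /f scale0r addr0 scale1r addrC subrK ge_min vt le_max tw orbT.
by rewrite in_itv; exists h.
Qed.

End L1norm.

(** * Affine hulls, and relative interior points of faces of the l1 ball *)

Section AffineHull.
Context {R : realType} {n : nat}.
Implicit Types (v c : 'cV[R]_n) (A : set 'cV[R]_n).

(** A translate of the kernel of [c^T]. The dimension stays existential because [c] may be zero. *)
Lemma affine_subspace_dotp c v :
  exists d, affine_subspace d [set w | dotp c w = dotp c v].
Proof.
pose U := lker (linfun (mulmx c^T : 'cV[R]_n -> 'M[R]_1)).
exists (\dim U), v, U; split=> //; apply/seteqP; split=> w /=.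
  move=> cw; rewrite memv_ker lfunE /=; apply/eqP/rowP => i.
  by rewrite ord1 -dotp_trmul dotpDr dotpNr cw subrr mxE.
rewrite memv_ker lfunE /= => /eqP/matrixP/(_ 0 0).
by rewrite -dotp_trmul dotpDr dotpNr mxE => /eqP; rewrite subr_eq0 => /eqP.
Qed.

(** A point of [A] exhibits the level set as an affine subspace, hence as one of the sets whose
    intersection is the hull. *)
Lemma affine_hull_dotp c m A : A !=set0 -> (forall v, A v -> dotp c v = m) ->
  forall v, affine_hull A v -> dotp c v = m.
Proof.
move=> [v Av] cA; have <- := cA v Av.
by apply: smallest_sub (affine_subspace_dotp c v) _ => w /cA /= ->; rewrite cA.
Qed.

Lemma dim_addv_line (K : fieldType) (vT : vectType K) (U : {vspace vT})
    (v : vT) :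
  v \notin U -> \dim (U + <[v]>)%VS = (\dim U).+1.
Proof.
move=> vU; have v0 : v != 0 by apply: contraNneq vU => ->; exact: mem0v.
rewrite dimv_disjoint_sum ?dim_vline ?v0 ?addn1 //.
apply/eqP; rewrite -subv0; apply/subvP => u; rewrite memv_cap.
case/andP=> uU /vlineP[k uk]; rewrite memv0; apply: contraNT vU => u0.
have k0 : k != 0 by apply: contraNneq u0 => k0; rewrite uk k0 scale0r.
by rewrite -[v](scalerK k0) -uk memvZ.
Qed.

End AffineHull.

(** Suppose [beta j 0 = 0] with [j != alpha]. A dimension count gives [c j 0] the maximal modulus,
    so [F] contains a vertex on axis [j]. Relative interiority lets [beta] move slightly away from
    that vertex inside [F], and coordinate [j] then has the wrong sign. *)
Lemma l1ball_facet_coords (R : realType) (n : nat) (t : R) (alpha : 'I_n)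
    (F : set 'cV[R]_n) (beta : 'cV[R]_n) : (2 <= n)%N ->
  0 < t -> face_of_dim n.-2 (l1ball t) F ->
  F `<=` [set v : 'cV[R]_n | v alpha 0 = 0] ->
  relative_interior F beta ->
  forall j, j != alpha -> beta j 0 != 0.
Proof.
move=> n2 t0 [[c [m [cm FE]]] [v0 [U [dimU hullE]]]] F_alpha [Fbeta betaI].
have FP v : F v <-> l1ball t v /\ dotp c v = m by rewrite FE.
have [bt bm] := (FP beta).1 Fbeta.
have [M [M0 mM cM _]] := l1ball_support t0 cm bt bm.
(* The constant is the same for all points of [F], being determined by [m = t * M]. *)
have Fsign v j : F v -> v j 0 != 0 -> c j 0 = M * Num.sg (v j 0).
  move=> /FP[vt vm]; have [M' [_ mM' _]] := l1ball_support t0 cm vt vm.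
  suff -> : M = M' by apply.
  by apply: (mulfI (lt0r_neq0 t0)); rewrite -mM.
pose vertex j : 'cV[R]_n := t * Num.sg (c j 0) *: delta_mx j 0.
have Fvertex j : `|c j 0| = M -> F (vertex j).
  move=> cj; apply/FP; rewrite dotp_vertex cj; split=> //.
  exact/l1ball_vertex/ltW.
(* If [M = 0] then [c = 0] and [F] is the whole ball, which is not contained in the hyperplane. *)
have Mgt0 : 0 < M.
  rewrite lt_neqAle M0 andbT; apply/eqP => M_eq0.
  have c0 : c = 0.
    by apply/colP => j; have := cM j; rewrite -M_eq0 normr_le0 mxE => /eqP.
  have : F (t *: delta_mx alpha 0).
    apply/FP; split; last first.
      by rewrite c0 dotp_trmul trmx0 mul0mx mxE mM -M_eq0 mulr0.
    by rewrite /l1ball /= l1normZ l1norm_delta mulr1 ger0_norm // ltW.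
  by move=> /F_alpha; rewrite /= !mxE !eqxx mulr1 => /eqP; rewrite gt_eqF.
have beta_hull : affine_hull F beta by apply: sub_gen_smallest.
have hull_move u (h : R) : u \in U -> affine_hull F (beta + h *: u).
  move: beta_hull; rewrite hullE /= => bU uU.
  by rewrite addrAC rpredD // rpredZ.
have U_dotp a k u : (forall v, F v -> dotp a v = k) -> u \in U -> dotp a u = 0.
  move=> ak uU; have F0 : F !=set0 by exists beta.
  have := affine_hull_dotp F0 ak (hull_move u 1 uU).
  by rewrite dotpDr (ak _ Fbeta) dotpZr mul1r -[RHS]addr0 => /addrI.
have U_coord j u : (forall v, F v -> v j 0 = 0) -> u \in U -> u j 0 = 0.
  move=> j0 uU; have := @U_dotp (delta_mx j 0) 0 u _ uU.
  by rewrite dotpC dotp_delta; apply => v /j0; rewrite dotpC dotp_delta.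
have [k bk] : exists k, beta k 0 != 0.
  apply/existsP; rewrite -negb_forall; apply/negP => /forallP b0.
  have beta0 : beta = 0 by apply/colP => j; rewrite mxE; apply/eqP.
  have : 0 < m by rewrite mM mulr_gt0.
  by rewrite -bm beta0 dotp_trmul mulmx0 mxE ltxx.
have k_alpha : k != alpha by apply: contraNneq bk => ->; rewrite F_alpha.
have ck : c k 0 != 0.
  by rewrite (Fsign _ _ Fbeta bk) mulf_neq0 ?sgr_eq0 // lt0r_neq0.
(* If |c_j| < M, then F lies in the subspace cut out by three independent
   linear equations, one too many for its dimension. *)
have c_max j : j != alpha -> `|c j 0| = M.
  move=> j_alpha; apply/eqP/negPn/negP => cjM.
  have Fj v : F v -> v j 0 = 0.
    move=> Fv; apply/eqP/negPn/negP => vj; case/negP: cjM.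
    by rewrite (Fsign _ _ Fv vj) normrM normr_sg vj mulr1 ger0_norm.
  have kj : k != j by apply: contraNneq bk => ->; rewrite Fj.
  (* The form [c] and the coordinates [j] and [alpha] vanish on [U]. So adjoining [e k], [e j],
     [e alpha] in turn raises the dimension each time, from [n.-2] to [n + 1]. *)
  pose e i : 'cV[R]_n := delta_mx i 0.
  have ek : e k \notin U.
    apply: contraNN ck => ekU.
    have := U_dotp c m _ (fun v Fv => ((FP v).1 Fv).2) ekU.
    by rewrite dotp_delta => ->.
  have ej : e j \notin (U + <[e k]>)%VS.
    apply/negP => /memv_addP[u uU [w /vlineP[a ->]]] /colP/(_ j).
    rewrite !mxE (U_coord j u Fj uU) !eqxx [j == k]eq_sym (negbTE kj).
    rewrite mulr0 addr0.
    by move/eqP; rewrite oner_eq0.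
  have ea : e alpha \notin (U + <[e k]> + <[e j]>)%VS.
    apply/negP => /memv_addP[w1 /memv_addP[u uU [w /vlineP[a ->]]] ->].
    move=> [w' /vlineP[a' ->]] /colP/(_ alpha).
    rewrite !mxE (U_coord alpha u F_alpha uU) !eqxx.
    rewrite [alpha == k]eq_sym (negbTE k_alpha).
    rewrite [alpha == j]eq_sym (negbTE j_alpha).
    by rewrite !mulr0 !addr0 => /eqP; rewrite oner_eq0.
  have := dimvS (subvf (U + <[e k]> + <[e j]> + <[e alpha]>)%VS).
  rewrite !dim_addv_line // dimU dimvf /dim /= muln1.
  by rewrite -[X in (_ <= X)%N](subnK n2) subn2 addn2 ltnn.
move=> j j_alpha; apply/eqP => bj0; have cjM := c_max j j_alpha.
have u_U : beta - vertex j \in U.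
  have : affine_hull F (vertex j) by apply: sub_gen_smallest; apply: Fvertex.
  move: beta_hull; rewrite hullE /= => bU wU.
  by have := rpredB bU wU; rewrite opprB addrA subrK.
move: betaI; rewrite /within /= => /nbhs_ballP[e /= e0 He].
(* Dividing by [L] makes every entry of the displacement strictly smaller than the radius [e]; the
   summand 1 supplies the strictness. *)
pose L := 1 + l1norm (beta - vertex j).
have L0 : 0 < L by rewrite ltr_pwDl // l1norm_ge0.
have Fmove : F (beta + (e / L) *: (beta - vertex j)).
  apply: He (hull_move _ _ u_U); split=> // i i'; rewrite ord1.
  rewrite /ball /= !mxE opprD addrA subrr add0r normrN normrM.
  rewrite ger0_norm ?divr_ge0 ?(ltW e0) ?(ltW L0) // mulrAC ltr_pdivrMr //.
  rewrite ltr_pM2l //.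
  apply: le_lt_trans (_ : l1norm (beta - vertex j) < L); last by rewrite ltrDr.
  by have := ler_l1norm (beta - vertex j) i; rewrite !mxE.
have cj0 : c j 0 != 0 by rewrite -normr_eq0 cjM lt0r_neq0.
(* As [beta j 0 = 0], the moved point has a [j]-th coordinate of sign opposite to [c j 0]. The sign
   rule then makes [c j 0] equal to its own negative. *)
have := Fsign _ j Fmove.
have eL : 0 < e / L by rewrite divr_gt0.
move: (e / L) eL => h h0.
rewrite !mxE bj0 add0r sub0r !eqxx mulr1 mulrN oppr_eq0.
rewrite !mulf_eq0 sgr_eq0 (negbTE cj0) (gt_eqF h0) (gt_eqF t0) => /(_ isT).
rewrite sgrN !sgrM (gtr0_sg h0) (gtr0_sg t0) !mul1r sgr_id => cE.
by move/eqP: cj0; have := numEsg (c j 0); rewrite cjM; lra.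
Qed.


(** * Identifying the coordinate hyperplane with the space of one dimension less *)

Section Embedding.
Context {R : realType} {n : nat} (alpha : 'I_n).
Implicit Types (u : 'cV[R]_n) (v w : 'cV[R]_n.-1).

Definition insert0 v : 'cV[R]_n :=
  \col_i oapp (fun j => v j 0) 0 (unlift alpha i).

Lemma insert0_alpha v : insert0 v alpha 0 = 0.
Proof. by rewrite mxE unlift_none. Qed.

Lemma insert0_lift v j : insert0 v (lift alpha j) 0 = v j 0.
Proof. by rewrite mxE liftK. Qed.

Lemma row'_insert0 v : row' alpha (insert0 v) = v.
Proof. by apply/colP => j; rewrite mxE insert0_lift. Qed.

Lemma insert0_row' u : u alpha 0 = 0 -> insert0 (row' alpha u) = u.
Proof.
move=> u0; apply/colP => i; rewrite mxE.
by case: unliftP => [j ->|->] /=; rewrite ?mxE.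
Qed.

Lemma l1norm_insert0 v : l1norm (insert0 v) = l1norm v.
Proof.
rewrite /l1norm (bigD1_ord alpha) //= insert0_alpha normr0 add0r.
by apply: eq_bigr => j _; rewrite insert0_lift.
Qed.

Lemma dotp_insert0 u v : dotp u (insert0 v) = dotp (row' alpha u) v.
Proof.
rewrite /dotp (bigD1_ord alpha) //= insert0_alpha mulr0 add0r.
by apply: eq_bigr => j _; rewrite insert0_lift mxE.
Qed.

Lemma row'_mul_insert0 (M : 'M[R]_n) v :
  row' alpha (M *m insert0 v) = row' alpha (col' alpha M) *m v.
Proof.
apply/colP => i; rewrite !mxE (bigD1_ord alpha) //= insert0_alpha mulr0 add0r.
by apply: eq_bigr => j _; rewrite insert0_lift !mxE.
Qed.

Lemma quad_objective_insert0 (M : 'M[R]_n) c v :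
  quad_objective M c (insert0 v) =
    quad_objective (row' alpha (col' alpha M)) (row' alpha c) v.
Proof. by rewrite /quad_objective !dotp_insert0 row'_mul_insert0. Qed.

Lemma posdef_principal (M : 'M[R]_n) :
  posdef M -> posdef (row' alpha (col' alpha M)).
Proof.
move=> [MT Mpos]; split.
  by apply/matrixP => i j; rewrite !mxE -[in LHS]MT mxE.
move=> v v0; rewrite -row'_mul_insert0 -dotp_insert0; apply: Mpos.
apply: contraNneq v0 => v0; rewrite -(row'_insert0 v) v0.
  by apply/eqP/colP => j; rewrite !mxE.
Qed.

Lemma unique_minimizer_insert0 (M : 'M[R]_n) c t u :
  u alpha 0 = 0 ->
  unique (minimizer (quad_objective M c) (l1ball t)) u ->
  unique (minimizer (quad_objective (row' alpha (col' alpha M)) (row' alpha c))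
    (l1ball t)) (row' alpha u).
Proof.
move=> u0 [[ut umin] uuniq].
have ball0 v : l1ball t v -> l1ball t (insert0 v).
  by rewrite /l1ball /= l1norm_insert0.
split.
  split=> [|w wt]; first by rewrite /l1ball /= -l1norm_insert0 insert0_row'.
  by rewrite -!quad_objective_insert0 insert0_row' //; apply/umin/ball0.
(* Uniqueness is inherited: the value at [insert0 w] is at most that at [u], so [insert0 w] also
   minimizes over the full ball. *)
move=> w [wt wmin]; rewrite (uuniq (insert0 w)) ?row'_insert0 //.
split=> [|z zt]; first exact: ball0.
apply: le_trans (umin _ zt); have := wmin (row' alpha u).
rewrite -!quad_objective_insert0 insert0_row' //; apply.
by rewrite /l1ball /= -l1norm_insert0 insert0_row'.
Qed.

End Embedding.

(** * From the data to the quadratic form: consequences of full rank *)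

Section Covariance.
Context {R : realType} {N p : nat}.
Variables (x : 'I_N -> 'cV[R]_p) (y : 'I_N -> R).
Implicit Types (v : 'cV[R]_p).

Lemma mul_outer (u v : 'cV[R]_p) : u *m u^T *m v = dotp u v *: u.
Proof.
by rewrite -mulmxA [u^T *m v]mx11_scalar mul_mx_scalar -dotp_trmul.
Qed.

Lemma dotp_suml (G : 'I_N -> 'cV[R]_p) v :
  dotp (\sum_i G i) v = \sum_i dotp (G i) v.
Proof.
apply: (big_morph (fun u => dotp u v)) => [u w|]; first exact: dotpDl.
by rewrite dotp_trmul trmx0 mul0mx mxE.
Qed.

Lemma covariance_form v :
  dotp (covariance x *m v) v = N%:R^-1 * \sum_i dotp (x i) v ^+ 2.
Proof.
rewrite /covariance -scalemxAl dotpZl mulmx_suml dotp_suml; congr (_ * _).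
by apply: eq_bigr => i _; rewrite mul_outer dotpZl expr2.
Qed.

Lemma cross_moment_form v :
  dotp (cross_moment x y) v = N%:R^-1 * \sum_i y i * dotp (x i) v.
Proof.
rewrite /cross_moment dotpZl dotp_suml; congr (_ * _).
by apply: eq_bigr => i _; rewrite dotpZl.
Qed.

Lemma lasso_objective_quad v : (0 < N)%N ->
  lasso_objective x y v =
    2^-1 * \sum_i y i ^+ 2
    + N%:R / 2 * quad_objective (covariance x) (cross_moment x y) v.
Proof.
move=> N0; rewrite /quad_objective covariance_form cross_moment_form.
have -> : lasso_objective x y v = 2^-1 *
    (\sum_i y i ^+ 2 - 2 * \sum_i y i * dotp (x i) v
     + \sum_i dotp (x i) v ^+ 2).
  rewrite /lasso_objective mulr_sumr -sumrB -big_split; congr (_ * _).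
  apply: eq_bigr => i _ /=.
  have -> : \sum_j v j 0 * x i j 0 = dotp (x i) v by rewrite dotpC.
  by ring.
field; by rewrite pnatr_eq0 -lt0n.
Qed.

Lemma lasso_minimizerE t v : (0 < N)%N ->
  minimizer (lasso_objective x y) (l1ball t) v <->
  minimizer (quad_objective (covariance x) (cross_moment x y)) (l1ball t) v.
Proof.
move=> N0; have N2 : 0 < N%:R / 2 :> R by rewrite divr_gt0 ?ltr0n.
by split=> -[vt vmin]; split=> // w /vmin;
  rewrite !lasso_objective_quad // lerD2l ler_pM2l.
Qed.

(** The orthogonal complement of [c] contains the data, hence is the whole space and contains [c]
    itself. *)
Lemma full_rank_orthogonal (c : 'cV[R]_(p + 1)) :
  full_rank x y -> (forall i, dotp c (data_point x y i) = 0) -> c = 0.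
Proof.
move=> rk c0; have [d Ad] := affine_subspace_dotp c 0.
have dotpc0 : dotp c 0 = 0 by rewrite dotp_trmul mulmx0 mxE.
have AT := rk d _ Ad (fun i => etrans (c0 i) (esym dotpc0)).
have : [set w | dotp c w = dotp c 0] c by rewrite AT.
by rewrite /= dotpc0; apply: dotp_eq0.
Qed.

Lemma full_rank_card_gt0 : full_rank x y -> (0 < N)%N.
Proof.
move=> rk; rewrite lt0n; apply/eqP => N0.
(* Without data points every vector is vacuously orthogonal to the data, even this nonzero one. *)
have /colP/(_ (rshift p 0)) : (col_mx 0 1%:M : 'cV[R]_(p + 1)) = 0.
  by apply: full_rank_orthogonal => // i; have := ltn_ord i; rewrite {2}N0.
by rewrite col_mxEd !mxE => /eqP; rewrite oner_eq0.
Qed.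

Lemma full_rank_posdef : full_rank x y -> posdef (covariance x).
Proof.
move=> rk; have N0 := full_rank_card_gt0 rk; split.
  rewrite /covariance linearZ /= linear_sum /=; congr (_ *: _).
  by apply: eq_bigr => i _; rewrite trmx_mul trmxK.
move=> v v0; rewrite covariance_form mulr_gt0 ?invr_gt0 ?ltr0n //.
rewrite lt_neqAle sumr_ge0 => [|i _]; last exact: sqr_ge0.
rewrite andbT eq_sym; apply: contraNneq v0 => /eqP.
rewrite psumr_eq0 => [/allP xv0|i _]; last exact: sqr_ge0.
(* A vanishing mean of squares makes [v], padded by 0 in the response coordinate, orthogonal to all
   data points. *)
have c0 : col_mx v (0 : 'M_1) = 0.
  apply: full_rank_orthogonal => // i.
  rewrite dotp_trmul tr_col_mx mul_row_col trmx0 mul0mx addr0 -dotp_trmul dotpC.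
  by apply/eqP; rewrite -sqrf_eq0; apply: xv0; rewrite mem_index_enum.
by have := congr1 usubmx c0; rewrite col_mxKu linear0 => ->.
Qed.

Lemma covariance_row' alpha :
  covariance (fun i => row' alpha (x i)) =
    row' alpha (col' alpha (covariance x)).
Proof.
apply/matrixP => j k; rewrite !mxE !summxE; congr (_ * _).
by apply: eq_bigr => i _; rewrite !mxE !big_ord1 !mxE.
Qed.

End Covariance.

(** The segment from a point of the ball to the centre crosses the sphere, and the objective does
    not increase on the way: its centred part is scaled by [(1 - h) ^+ 2]. *)
Lemma minimizer_sphere_ball (R : realType) (n : nat) (M : 'M[R]_n) c t v :
  posdef M -> t <= l1norm (invmx M *m c) -> l1norm v = t ->
  (forall w, l1norm w = t ->
    quad_objective M c v <= quad_objective M c w) ->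
  minimizer (quad_objective M c) (l1ball t) v.
Proof.
move=> Mpd to vt vmin; split=> [|w wt]; first by rewrite /l1ball /= vt.
set o := invmx M *m c in to.
have [|h /andP[h0 h1] ht] := @l1sphere_crossing _ _ t w o; first exact/andP.
apply: le_trans (vmin _ ht) _.
rewrite !(quad_objective_center c _ Mpd) -/o lerD2l.
have -> : w + h *: (o - w) - o = (1 - h) *: (w - o).
  by apply/colP => j; rewrite !mxE; ring.
rewrite -scalemxAr dotpZl dotpZr mulrA.
by rewrite ler_piMl ?posdef_ge0 //; nra.
Qed.

(** * From the contact condition to the induced lasso and its sign equations *)

Unset Implicit Arguments.

Theorem theorem3p4 (R : realType) (N p : nat)
    (x : 'I_N -> 'cV[R]_p) (y : 'I_N -> R) (t r : R)
    (alpha : 'I_p) (F : set 'cV[R]_p) (beta : 'cV[R]_p) :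
  (2 <= p)%N ->
  centred x y ->
  full_rank x y ->
  0 < t -> t < l1norm (ols x y) ->
  smallest_touching x y t r ->
  (equimomental x y r `&` l1sphere t) beta ->
  face_of_dim p.-2 (l1ball t) F ->
  F `<=` [set v : 'cV[R]_p | v alpha 0 = 0] ->
  relative_interior F beta ->
  let K := row' alpha (col' alpha (covariance x)) in
  let b := row' alpha (cross_moment x y) in
  let gamma := row' alpha beta in
  let delta := sign_vector gamma in
  [/\ lasso_solution x y t beta /\ beta alpha 0 = 0,
      induced_lasso_solution x y alpha t gamma,
      (forall j, delta j 0 = 1 \/ delta j 0 = -1) /\
        (exists s : R, s < 0 /\ K *m gamma - b = s *: delta),
      covariance (fun i => row' alpha (x i)) = K &
      level_sets_are_ellipsoids (induced_objective x y alpha) K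
        (invmx K *m b)].
Proof.
move=> p2 _ rk t0 t_ols [_ r_min] [beta_r beta_t] Fface F_alpha betaF.
move=> K b gamma delta.
have N0 := full_rank_card_gt0 rk; have Mpd := full_rank_posdef rk.
set M := covariance x in Mpd *; set c := cross_moment x y.
have beta_alpha : beta alpha 0 = 0 by apply: F_alpha; case: betaF.
have beta_neq0 := l1ball_facet_coords p2 t0 Fface F_alpha betaF.
have beta_min : minimizer (quad_objective M c) (l1ball t) beta.
  apply: minimizer_sphere_ball => // [|w wt]; first exact: ltW.
  (* Up to a common constant, the objective is the ellipsoid level: [r] at [beta], and at least [r]
     elsewhere on the sphere. *)
  rewrite !(quad_objective_center c _ Mpd) lerD2l.
  move: beta_r; rewrite /equimomental /ellipsoid /= => ->.
  by apply: r_min; exists w.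
have beta_uniq : unique (minimizer (quad_objective M c) (l1ball t)) beta.
  apply: quad_minimizer_unique => // w wt h h01.
  by apply: l1ball_convex => //; exact: beta_min.1.
pose g := c - M *m beta.
have g_max w : l1ball t w -> dotp g w <= dotp g beta.
  move=> wt; rewrite -subr_ge0.
  have := quad_variational_inequality Mpd beta_min
    (fun h => l1ball_convex beta_min.1 wt).
  by rewrite /g !dotpE; lra.
have [G [G0 _ gG g_sg]] := l1ball_support t0 g_max beta_min.1 erefl.
have Ggt0 : 0 < G.
  rewrite lt_neqAle G0 andbT; apply: contraTneq t_ols => G_eq0.
  have Mbeta : M *m beta = c.
    apply/esym/eqP; rewrite -subr_eq0 -/g; apply/eqP/colP => j.
    by have := gG j; rewrite -G_eq0 normr_le0 => /eqP ->; rewrite mxE.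
  by rewrite /ols -/M -/c -Mbeta mulKmx ?posdef_unitmx // beta_t ltxx.
have gamma_neq0 j : gamma j 0 != 0.
  by rewrite mxE beta_neq0 // eq_sym neq_lift.
have gammaE : insert0 alpha gamma = beta by rewrite insert0_row'.
split; [| | |exact: covariance_row'|exact/posdef_level_sets/posdef_principal].
- split=> //; split; first exact/lasso_minimizerE.
  by move=> w /lasso_minimizerE - /(_ N0) /beta_uniq.2.
- exact: unique_minimizer_insert0.
- split=> [j|].
    by rewrite mxE; case: sgrP (gamma_neq0 j) => // _ _; [left | right].
  exists (- G); split; first by rewrite oppr_lt0.
  (* Since [beta] vanishes at [alpha], column [alpha] of [M] does not contribute, so [K *m gamma] is
     [M *m beta] with row [alpha] deleted. *)
  rewrite -row'_mul_insert0 gammaE scaleNr.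
  have -> : row' alpha (M *m beta) - b = - row' alpha g.
    by rewrite /g linearB /= opprB.
  congr (- _); apply/colP => j; rewrite [LHS]mxE [RHS]mxE [delta _ _]mxE.
  have -> : gamma j 0 = beta (lift alpha j) 0 by rewrite mxE.
  by rewrite g_sg // beta_neq0 // eq_sym neq_lift.
Qed.
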